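(* Let $r>0$ and $\mu>0$. Let $\phi_r(y)=\exp(-|y|^r/r)/C_r$ for $y\in\mathbb R$, where $C_r=2\Gamma(1/r)r^{(1/r)-1}$, and let $\Phi_r(x)=\int_{-\infty}^x\phi_r(y)\,dy$ be the generalized normal (Subbotin) distribution function. Then the distribution function $$F_{\mu,r}(y)\equiv1-\Phi_r\bigl(\Phi_r^{-1}(1-y)-\mu\bigr),\qquad 0<y<1,$$ is regularly varying at $0$ with exponent $1$; that is, for any $c>0$, $$\lim_{y\to0+}\frac{F_{\mu,r}(cy)}{F_{\mu,r}(y)}=c .$$
   Context: $\Gamma$ is the Gamma function; $C_r$ is the normalizing constant making $\phi_r$ a probability density. $\Phi_r^{-1}$ is the inverse of the strictly increasing function $\Phi_r:\mathbb R\to(0,1)$. *)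

(* Defs.v *)
From mathcomp Require Import all_boot all_order all_algebra.
From mathcomp Require Import all_classical all_reals all_analysis.

Set Implicit Arguments.
Unset Strict Implicit.
Unset Printing Implicit Defensive.

Import Order.TTheory GRing.Theory Num.Theory.
Import numFieldNormedType.Exports.

Local Open Scope classical_set_scope.
Local Open Scope ring_scope.

(* Euler's integral; it is the Gamma function for [0 < s], and only such [s]
   are used below. *)
Definition Gamma {R : realType} (s : R) : R :=
  \int[@lebesgue_measure R]_(t in `]0, +oo[) (t `^ (s - 1) * expR (- t)).

Definition subbotin_norm {R : realType} (r : R) : R :=
  2 * Gamma (1 / r) * r `^ (1 / r - 1).

Definition subbotin_pdf {R : realType} (r y : R) : R :=
  expR (- (`|y| `^ r / r)) / subbotin_norm r.

Definition subbotin_cdf {R : realType} (r x : R) : R :=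
  \int[@lebesgue_measure R]_(y in `]-oo, x]) subbotin_pdf r y.

(* [pinv_] is the inverse of [subbotin_cdf r] on its range, which is the open
   interval (0, 1) for [0 < r]; the default 0 is a junk value that is taken
   only outside that range. *)
Definition subbotin_quantile {R : realType} (r : R) : R -> R :=
  'pinv_(fun=> 0) [set: R] (subbotin_cdf r).

(* Relevant for [0 < y < 1] only. *)
Definition shifted_pvalue_cdf {R : realType} (mu r y : R) : R :=
  1 - subbotin_cdf r (subbotin_quantile r (1 - y) - mu).

(* Main.v *)
Require Import Defs.
From mathcomp Require Import all_boot all_order all_algebra.
From mathcomp Require Import all_classical all_reals all_analysis.
From mathcomp Require Import measurable_realfun ring lra.

Import Order.TTheory GRing.Theory Num.Theory.
Import numFieldNormedType.Exports.

Local Open Scope classical_set_scope.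
Local Open Scope ring_scope.

(** Write [S := 1 - subbotin_cdf r] for the tail function, [phi] for the density
    and [h := phi / S] for the hazard rate, and let [x_y] be the point with
    [S x_y = y], so that the function studied is [F y = S (x_y - mu)].  The
    mechanism is that shifting by [mu] does not change the hazard rate
    asymptotically: [h (x - mu) / h x] tends to [1].  Since
    [(ln S)' = - h], for [c] distinct from [1] Cauchy's mean value theorem gives
    a point [xi] between [x_y] and [x_(c y)] with
    [(ln (F (c y)) - ln (F y)) / (ln (c y) - ln y) = h (xi - mu) / h xi],
    and [xi] goes to infinity as [y] goes to [0].  Hence
    [ln (F (c y) / F y)] tends to [ln c] ([ln_survival_shift]).

    The asymptotics of [h] come from the Mills ratio
    [x `^ (1 - r) * phi x / S x --> 1] ([cvg_subbotin_mills]), by l'Hopital's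
    rule: the derivative of [x `^ (1 - r) * phi x] is
    [((1 - r) * x `^ (- r) - 1) * phi x] and that of [S] is [- phi x].  So [h x]
    is equivalent to [x `^ (r - 1)], for which the invariance under shifts is
    clear ([subbotin_hazard_shift]).

    All of this needs [S] to vanish at infinity, that is, the constant
    [2 * Gamma (1 / r) * r `^ (1 / r - 1)] to be the total mass of
    [exp (- |y|^r / r)] ([subbotin_normE]).  This is the substitution
    [t = y^r / r] in Euler's integral; as the derivative of the substitution is
    in general unbounded near one end of the half-line, it is obtained from the
    fundamental theorem of calculus on [[1/n, +oo[], applied to the primitive of
    the weight composed with [t |-> (r t)^(1/r)], and from monotone convergence.
*)

Set Implicit Arguments.
Unset Strict Implicit.
Unset Printing Implicit Defensive.

(** * Limits and continuity of power functions *)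

Lemma continuous_norm_powR {R : realType} (r : R) : 0 < r ->
  continuous (fun y : R => `|y| `^ r).
Proof.
move=> r_gt0 y; have [->|y0] := eqVneq y 0.
  rewrite /continuous_at normr0 powR0 ?gt_eqF//.
  apply/cvgr0Pnorm_lt => e e0; near=> z.
  rewrite ger0_norm ?powR_ge0//.
  rewrite -[ltRHS]powRr1 ?(ltW e0)// -(mulVf (lt0r_neq0 r_gt0)) powRrM.
  rewrite gt0_ltr_powR ?nnegrE ?powR_ge0//.
  near: z; apply: (@cvgr0_norm_lt R R^o R (nbhs 0) _ id) => //.
  by rewrite powR_gt0.
apply: (@continuous_comp _ _ _ (fun y : R => `|y|) (@powR R ^~ r)).
  exact: norm_continuous.
apply/differentiable_continuous/derivable1_diffP/derivable_powR.
by rewrite in_itv/= andbT normr_gt0.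
Unshelve. all: by end_near. Qed.

Lemma cvgy_powR {R : realType} (p : R) : 0 < p -> x `^ p @[x --> +oo] --> +oo.
Proof.
move=> p0; apply/cvgryPgt => A; near=> x.
have x0 : 0 < x by near: x; exact: nbhs_pinfty_gt.
apply: (@le_lt_trans _ _ `|A|); first exact: ler_norm.
rewrite -[ltLHS]powRr1// -(mulVf (lt0r_neq0 p0)) powRrM.
rewrite gt0_ltr_powR ?nnegrE ?powR_ge0 ?(ltW x0)//.
Unshelve. all: by end_near. Qed.

Lemma cvg_powRN {R : realType} (p : R) : 0 < p ->
  x `^ (- p) @[x --> +oo] --> (0 : R).
Proof.
move=> p0; under eq_fun do rewrite powRN.
apply/gtr0_cvgV0; last exact: cvgy_powR.
near=> x; apply: powR_gt0; near: x; apply: nbhs_pinfty_gt; exact: num_real.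
Unshelve. all: by end_near. Qed.

(** * L'Hopital's rule at infinity *)

(** For fixed [x] the Cauchy quotient [(f y - f x) / (g y - g x)] tends to
    [f x / g x] as [y] goes to infinity, because [f] and [g] vanish there; the
    mean value theorem keeps this quotient as close to [l] as [df / dg] is
    beyond [x]. *)
Lemma lhopital_pinfty {R : realType} (f df g dg : R -> R) (l : R) :
  (\forall x \near +oo, is_derive (x : R) 1 f (df x)) ->
  (\forall x \near +oo, is_derive (x : R) 1 g (dg x)) ->
  (\forall x \near +oo, g x != 0) ->
  (\forall x \near +oo, dg x != 0) ->
  f x @[x --> +oo] --> 0 -> g x @[x --> +oo] --> 0 ->
  df x / dg x @[x --> +oo] --> l ->
  f x / g x @[x --> +oo] --> l.
Proof.
move=> fdf gdg g0 dg0 f0 gl0 dfdg; apply/cvgrPdist_le => e e0.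
have [A [_ HA]] : \forall x \near +oo, [/\ is_derive (x : R) 1 f (df x),
    is_derive (x : R) 1 g (dg x), g x != 0, dg x != 0 &
    `|l - df x / dg x| <= e].
  near=> x; split; near: x => //.
  by move/cvgrPdist_le : dfdg; exact.
exists A; split; first exact: num_real.
move=> x Ax.
have ftog : (f y - f x) / (g y - g x) @[y --> +oo] --> f x / g x.
  have -> : f x / g x = (0 - f x) / (0 - g x) by rewrite !sub0r invrN mulrNN.
  apply: cvgM; first by apply: cvgB => //; exact: cvg_cst.
  apply: cvgV; first by rewrite sub0r oppr_eq0; have [] := HA _ Ax.
  by apply: cvgB => //; exact: cvg_cst.
have dist : `|l - (f y - f x) / (g y - g x)| @[y --> +oo] --> `|l - f x / g x|.
  by apply: cvg_norm; apply: cvgB => //; exact: cvg_cst.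
apply: (cvgr_to_le dist); near=> y.
have xy : x < y by near: y; apply: nbhs_pinfty_gt; exact: num_real.
have [| | | | |c cxy <-] := @cauchy_MVT R f df g dg x y xy.
- apply: derivable_within_continuous => z; rewrite in_itv/= => /andP[xz _].
  by have [[]] := HA _ (lt_le_trans Ax xz).
- apply: derivable_within_continuous => z; rewrite in_itv/= => /andP[xz _].
  by have [_ []] := HA _ (lt_le_trans Ax xz).
- move=> z; rewrite in_itv/= => /andP[xz _].
  by have [] := HA _ (lt_trans Ax xz).
- move=> z; rewrite in_itv/= => /andP[xz _].
  by have [] := HA _ (lt_trans Ax xz).
- move=> z; rewrite in_itv/= => /andP[xz _].
  by have [] := HA _ (lt_trans Ax xz).
move: cxy; rewrite in_itv/= => /andP[xc _].
by have [] := HA _ (lt_trans Ax xc).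
Unshelve. all: by end_near. Qed.

(** * Shifting a survival function *)

Section survival.
Context {R : realType} (T p : R -> R) (mu : R).
Local Notation h x := (p x / T x).
Context (T_gt0 : forall x, 0 < T x) (p_gt0 : forall x, 0 < p x)
  (dT : forall x : R, is_derive x 1 T (- p x))
  (hmu : (h (x - mu) / h x) @[x --> +oo%R] --> (1:R)).

Lemma is_derive_ln_survival (a x : R) :
  is_derive x 1 (fun x : R => ln (T (x - a))) (- h (x - a)).
Proof.
have dB : is_derive x 1 (fun x : R => x - a) 1.
  by apply: is_derive_eq; rewrite subr0.
have dTB := @is_derive1_comp R T (fun x : R => x - a) x _ _ (dT (x - a)) dB.
have dln := is_derive1_ln (T_gt0 (x - a)).
have := @is_derive1_comp R (@ln R) (T \o (fun x : R => x - a)) x _ _ dln dTB.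
by rewrite mulr1 mulrN mulrC.
Qed.

(** The quotient of the increments of [ln T (x - mu)] and of [ln T x] between [a]
    and [b] is, by Cauchy's mean value theorem, the ratio of hazard rates
    [h (c - mu) / h c] at an intermediate [c], hence close to [1] far out.  The
    product form covers [a = b] as well. *)
Lemma ln_survival_shift e : 0 < e -> exists A, forall a b, A < a -> A < b ->
  `|ln (T (b - mu)) - ln (T (a - mu)) - (ln (T b) - ln (T a))| <=
  e * `|ln (T b) - ln (T a)|.
Proof.
move=> e0.
have [A [_ HA]] : \forall x \near +oo, `|1 - h (x - mu) / h x| <= e.
  by move/cvgrPdist_le : hmu; exact.
exists A.
suff H a b : A < a -> a < b ->
  `|ln (T (b - mu)) - ln (T (a - mu)) - (ln (T b) - ln (T a))| <=
  e * `|ln (T b) - ln (T a)|.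
  move=> a b Aa Ab; have [ab|ba|->] := ltgtP a b; first exact: H.
    rewrite -normrN [X in _ * X]distrC opprB addrC opprB.
    by have := H _ _ Ab ba; rewrite [X in `|X|]addrC opprB addrC.
  by rewrite !subrr normr0 mulr0.
move=> Aa ab.
have d0 (x : R) : is_derive x 1 (fun x : R => ln (T x)) (- h x).
  have := is_derive_ln_survival 0 x; rewrite subr0.
  by under eq_fun do rewrite subr0.
have h_gt0 x : 0 < h x by rewrite divr_gt0.
have h0 x : - h x != 0 by rewrite oppr_eq0 gt_eqF.
have cU : {within `[a, b], continuous (fun x : R => ln (T (x - mu)))}.
  apply: derivable_within_continuous => z _.
  by have [] := is_derive_ln_survival mu z.
have cV : {within `[a, b], continuous (fun x : R => ln (T x))}.
  by apply: derivable_within_continuous => z _; have [] := d0 z.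
have V0 := differentiable_subr_neq0 ab cV (fun x _ => d0 x) (fun x _ => h0 x).
have [c cab ce] := cauchy_MVT ab cU cV (fun x _ => is_derive_ln_survival mu x)
  (fun x _ => d0 x) (fun x _ => h0 x).
move: cab; rewrite in_itv/= => /andP[ac _].
have := HA _ (lt_trans Aa ac).
rewrite -[h (c - mu) / h c]mulrNN -invrN ce.
set u := ln _ - ln _ in V0 *; set v := ln _ - ln _ => uv.
rewrite -[v - u](_ : (1 - v / u) * - u = _).
  by rewrite normrM normrN ler_wpM2r.
by field.
Qed.
End survival.

(** * Primitives on the whole line *)

Lemma integrable_oneDsqrV {R : realType} :
  (@lebesgue_measure R).-integrable setT
    (EFin \o (fun x : R => (oneDsqr x)^-1)).
Proof.
apply/integrableP; split.
  apply/measurable_EFinP; apply: continuous_measurable_fun => x.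
  exact: continuous_oneDsqrV.
under eq_integral => x _ do rewrite /= ger0_norm ?invr_ge0//.
rewrite ge0_symfun_integralT.
- by rewrite -set_itvcy integral0y_oneDsqr -EFinM ltry.
- by move=> x; rewrite invr_ge0.
- by move=> x; exact: continuous_oneDsqrV.
- by move=> x; rewrite /= /oneDsqr sqrrN.
Qed.

Section cumulative.
Context {R : realType} (f : R -> R).
Local Notation mu := (@lebesgue_measure R).
Context (f_ge0 : forall x, 0 <= f x) (cf : continuous f)
  (intf : mu.-integrable setT (EFin \o f)).
Local Notation I x := (\int[mu]_(y in `]-oo, x]) f y).
Local Notation M := (\int[mu]_y f y).

Lemma is_derive_cumulative (x : R) : is_derive x 1 (fun x : R => I x : R) (f x).
Proof.
have xu : x < x + 1 by rewrite ltrDl.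
have fi : mu.-integrable `]-oo, x + 1] (EFin \o f).
  exact: integrableS intf.
have [dI Ix] := continuous_FTC1 xu fi (ltNyr x) (@cf x).
by apply: DeriveDef => //; rewrite -derive1E.
Qed.

Let fS D : measurable D -> mu.-integrable D (EFin \o f).
Proof. by move=> mD; exact: integrableS intf. Qed.

Lemma nondecreasing_cumulative : nondecreasing_fun (fun x : R => I x).
Proof.
move=> x y xy; rewrite -subr_ge0.
rewrite (@Rintegral_itvB _ _ -oo%O (BRight y)) ?bnd_simp//.
  exact: Rintegral_ge0.
exact: fS.
Qed.

Lemma cumulative_le x : I x <= M.
Proof.
rewrite -subr_ge0 -set_itvNyy (@Rintegral_itvB _ _ -oo%O +oo%O) ?bnd_simp//.
  exact: Rintegral_ge0.
exact: fS.
Qed.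

(** Monotonicity yields some limit along the reals; monotone convergence over
    the intervals [`]-oo, n]] identifies it along the integers. *)
Lemma cvg_cumulativey : I x @[x --> +oo] --> M.
Proof.
have cI : I x @[x --> +oo] --> sup (range (fun x => I x)).
  apply: nondecreasing_cvgr; first exact: nondecreasing_cumulative.
  by exists M => _ [x _ <-]; exact: cumulative_le.
have cIn : I n%:R @[n --> \oo] --> M.
  pose D n : set (measurableTypeR R) := `]-oo, n%:R]%classic.
  have bigD : \bigcup_n D n = setT.
    rewrite -subTset => t _/=.
    exists (Num.truncn t).+1 => //=.
    by rewrite /D/= in_itv/= ltW// Num.Theory.truncnS_gt.
  apply: fine_cvg; rewrite /Rintegral fineK ?integrable_fin_num// -bigD.
  apply: ge0_nondecreasing_set_cvg_integral => //.
  - move=> m n mn; apply/subsetPset => x /=; rewrite /D/= !in_itv/=.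
    by move/le_trans; apply; rewrite ler_nat.
  - by move=> i; have /integrableP[] := fS (measurable_itv `]-oo, i%:R]).
  - by move=> i x _; rewrite lee_fin.
move/cvg_pinftyP : (cI) => /(_ _ cvgr_idn) cIn'.
by rewrite -(cvg_unique _ cIn' cIn).
Qed.

Lemma cumulativeN : (forall x, f (- x) = f x) -> forall x, I (- x) = M - I x.
Proof.
move=> fN x; rewrite -[X in X - _]/(Rintegral _ setT _) -set_itvNyy.
rewrite (@Rintegral_itvB _ _ -oo%O +oo%O) ?bnd_simp//; last exact: fS.
rewrite /Rintegral; congr fine.
rewrite ge0_integration_by_substitutionNy//; last exact: continuous_subspaceT.
rewrite integral_itv_obnd_cbnd; last first.
  by have /integrableP[] := fS (measurable_itv `]x, +oo[).
by apply: eq_integral => y _ /=; rewrite fN.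
Qed.
End cumulative.

(** * The Subbotin weight *)

(** The density without its constant: [subbotin_norm] is only known to be the
    total mass once this weight has been integrated. *)
Definition subbotin_weight {R : realType} (r y : R) : R :=
  expR (- (`|y| `^ r / r)).

Section weight.
Context {R : realType} (r : R) (r_gt0 : 0 < r).
Local Notation mu := (@lebesgue_measure R).
Local Notation w := (subbotin_weight r).

Lemma subbotin_weight_gt0 y : 0 < w y.
Proof. exact: expR_gt0. Qed.

Lemma subbotin_weightN y : w (- y) = w y.
Proof. by rewrite /subbotin_weight normrN. Qed.

Lemma continuous_subbotin_weight : continuous w.
Proof.
move=> y; apply: (@continuous_comp _ _ _ (fun y : R => - (`|y| `^ r / r)) expR).
  apply: cvgN; apply: cvgMl; exact: continuous_norm_powR.
exact: continuous_expR.
Qed.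

Lemma subbotin_weight_le1 y : w y <= 1.
Proof.
by rewrite /subbotin_weight expR_le1 oppr_le0 divr_ge0 ?powR_ge0// ltW.
Qed.

(** For nonnegative [u], [expR u] is at least [u ^+ n.+1 / n.+1`!], so the weight
    decays faster than any power of [y]; the square is enough both for
    integrability and for the limit needed in the Mills ratio. *)
Lemma subbotin_weight_le : exists2 K : R, 0 < K &
  forall y, w y * (1 + y ^+ 2) <= K.
Proof.
have [n n2] : exists n : nat, 2 <= r * n.+1%:R.
  exists (Num.truncn (2 / r)); rewrite mulrC -ler_pdivrMr//.
  exact/ltW/Num.Theory.truncnS_gt.
(* The first summand is for [`|y|] at most [1], the second for the other case. *)
exists (2 + 2 * (n.+1`!%:R * r ^+ n.+1)).
  by rewrite ltr_pwDl// mulr_ge0// mulr_ge0// exprn_ge0// ltW.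
move=> y; have [y1|y1] := leP `|y| 1.
  have y21 : y ^+ 2 <= 1 by rewrite -real_normK ?num_real// expr_le1.
  apply: (@le_trans _ _ 2); last first.
    by rewrite lerDl !mulr_ge0// exprn_ge0// ltW.
  apply: (le_trans (ler_wpM2r _ (subbotin_weight_le1 y))).
    by rewrite addr_ge0// sqr_ge0.
  by rewrite mul1r; lra.
have y0 : 0 < `|y| by exact: lt_trans y1.
have y2 : y ^+ 2 <= (`|y| `^ r) ^+ n.+1.
  rewrite -real_normK ?num_real// -!powR_mulrn ?powR_ge0// -powRrM.
  by rewrite ler_powR// ltW.
set u := `|y| `^ r in y2.
have e1 : (u / r) ^+ n.+1 / n.+1`!%:R <= expR (u / r).
  apply: le_trans (expR_ge1Dxn n (divr_ge0 (powR_ge0 _ _) (ltW r_gt0))).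
  by rewrite lerDr.
have w2 : w y * y ^+ 2 <= n.+1`!%:R * r ^+ n.+1.
  rewrite /subbotin_weight -/u expRN mulrC ler_pdivrMr ?expR_gt0//.
  apply: (le_trans y2); move: e1.
  rewrite expr_div_n ler_pdivrMr ?ltr0n ?fact_gt0//.
  rewrite ler_pdivrMr ?exprn_gt0//.
  by rewrite -mulrA mulrC.
have y21 : 1 <= y ^+ 2.
  by rewrite -real_normK ?num_real// exprn_ege1// ltW.
apply: (@le_trans _ _ (w y * (2 * y ^+ 2))).
  rewrite ler_pM2l ?subbotin_weight_gt0//; lra.
rewrite mulrCA; apply: ler_wpDl => //.
by rewrite ler_pM2l.
Qed.

Lemma integrable_subbotin_weight : mu.-integrable setT (EFin \o w).
Proof.
have [K K0 wK] := subbotin_weight_le.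
apply: (le_integrable measurableT _ _
  (integrableZl measurableT K integrable_oneDsqrV)).
- apply/measurable_EFinP; apply: continuous_measurable_fun.
  exact: continuous_subbotin_weight.
- move=> x _; rewrite -EFinM /= lee_fin.
  rewrite !ger0_norm ?(ltW (subbotin_weight_gt0 _))//; last first.
    by rewrite mulr_ge0 ?(ltW K0)// invr_ge0.
  by rewrite ler_pdivlMr.
Qed.
End weight.

(** * The normalizing constant *)

Section norm.
Context {R : realType} (r : R) (r_gt0 : 0 < r).
Local Notation mu := (@lebesgue_measure R).
Local Notation w := (subbotin_weight r).
Local Notation I x := (\int[mu]_(y in `]-oo, x]) w y).
Local Notation M := (\int[mu]_y w y).

(** On [`]0, +oo[] Euler's integrand at [1 / r] is, up to the factor
    [r `^ (1 / r - 1)], the derivative of [t |-> I ((r t) `^ (1 / r))].  The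
    integral is thus the increment [M - I 0], which is half of the mass because
    the weight is even. *)
Lemma Gamma_integral_subbotin :
  (\int[mu]_(t in `]0%R, +oo[) (t `^ (1 / r - 1) * expR (- t))%R%:E =
   ((r `^ (1 / r - 1))^-1 * (M / 2))%R%:E)%E.
Proof.
have w0 y : 0 <= w y by exact/ltW/subbotin_weight_gt0.
have cw : continuous w by exact: continuous_subbotin_weight.
have iw := integrable_subbotin_weight r_gt0.
have r'0 : 0 < 1 / r by rewrite divr_gt0.
set c := r `^ (1 / r - 1).
have c0 : 0 < c by exact: powR_gt0.
pose k (t : R) := t `^ (1 / r - 1) * expR (- t).
(* The absolute value makes [H] continuous on the whole line, 0 included. *)
pose H (t : R) := c^-1 * I (`|r * t| `^ (1 / r)).
have I0 : I 0 = M / 2.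
  have := cumulativeN w0 cw iw (subbotin_weightN r) 0; rewrite oppr0 => e.
  lra.
have cI : continuous (fun x : R => I x : R).
  move=> x; apply/differentiable_continuous/derivable1_diffP.
  by have [] := is_derive_cumulative cw iw x.
have cH : continuous H.
  move=> t; apply: cvgMr.
  apply: (@continuous_comp _ _ _ (fun t : R => `|r * t| `^ (1 / r))
    (fun x : R => I x : R)).
    apply: (@continuous_comp _ _ _ (fun t : R => r * t)
      (fun x : R => `|x| `^ (1 / r))).
      exact: mulrl_continuous.
    exact: continuous_norm_powR.
  exact: cI.
have dH (t : R) : 0 < t -> is_derive t 1 H (k t).
  move=> t0; have rt0 : 0 < r * t by exact: mulr_gt0.
  have dI := is_derive_cumulative cw iw ((r * t) `^ (1 / r)).
  have dp : is_derive (r * t) 1 (@powR R ^~ (1 / r))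
      (1 / r * (r * t) `^ (1 / r - 1)).
    exact: is_derive1_powR.
  have dr : is_derive t 1 (fun t : R => r * t) r.
    by apply: is_derive_eq; rewrite /GRing.scale/= ?(mulr0, mulr1, addr0, add0r).
  have dc1 := is_derive1_comp dp dr.
  have dc2 := @is_derive1_comp R (fun x : R => I x : R)
    (@powR R ^~ (1 / r) \o *%R r) t _ _ dI dc1.
  have dc3 := is_deriveZ c^-1 dc2.
  rewrite (_ : k t = c^-1 *: (w ((r * t) `^ (1 / r)) *
      (1 / r * (r * t) `^ (1 / r - 1) * r))).
    apply: near_eq_is_derive dc3; near=> s.
    rewrite /H /= ger0_norm// mulr_ge0 ?(ltW r_gt0)//.
    by rewrite ltW//; near: s; exact: lt_nbhsr.
  rewrite /k /subbotin_weight /GRing.scale/= ger0_norm ?powR_ge0//.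
  rewrite -powRrM div1r mulVf ?gt_eqF// powRr1 ?(ltW rt0)//.
  rewrite [r * t / r]mulrAC mulfV ?gt_eqF// mul1r.
  rewrite powRM ?(ltW r_gt0) ?(ltW t0)// -div1r -/c.
  by field; rewrite !gt_eqF.
have ck (t : R) : 0 < t -> {for t, continuous k}.
  move=> t0; rewrite /k; apply: cvgM.
    have : derivable (@powR R ^~ (1 / r - 1)) t 1.
      by apply: derivable_powR; rewrite in_itv/= andbT.
    by move/derivable1_diffP/differentiable_continuous.
  apply: (@continuous_comp _ _ _ (fun t : R => - t) expR).
    exact: opp_continuous.
  exact: continuous_expR.
have k0 t : 0 <= k t by rewrite mulr_ge0 ?powR_ge0 ?expR_ge0.
have Hy : H t @[t --> +oo] --> c^-1 * M.
  apply: cvgMr.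
  apply: (@cvg_comp _ _ _ (fun t : R => `|r * t| `^ (1 / r))
    (fun x : R => I x : R)
    _ (+oo : set_system R)); last first.
    exact: cvg_cumulativey.
  apply: (@cvg_comp _ _ _ (fun t : R => `|r * t|)
    (fun x : R => x `^ (1 / r)) _ (+oo : set_system R)); last first.
    exact: cvgy_powR.
  apply/cvgryPgt => A; near=> t.
  apply: lt_le_trans (ler_norm _); rewrite mulrC -ltr_pdivrMr//.
  by near: t; apply: nbhs_pinfty_gt; exact: num_real.
have ik (a : R) : 0 < a ->
    (\int[mu]_(t in `[a, +oo[) (k t)%:E = (c^-1 * M - H a)%R%:E)%E.
  move=> a0; rewrite (@ge0_continuous_FTC2y _ k H a (c^-1 * M)) ?EFinB//.
  - apply: continuous_in_subspaceT => x; rewrite inE/= in_itv/= andbT => ta.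
    exact/ck/(lt_le_trans a0).
  - by move=> t ta; have [] := dH t (lt_trans a0 ta).
  - by apply: cvg_at_right_filter; exact: cH.
  - move=> t; rewrite in_itv/= andbT => ta; rewrite derive1E.
    by have [] := dH t (lt_trans a0 ta).
(* [k] need not be bounded near 0, whence the exhaustion by closed half-lines. *)
pose D n : set (measurableTypeR R) := `[n.+1%:R^-1, +oo[%classic.
have bigD : \bigcup_n D n = `]0, +oo[%classic.
  apply/seteqP; split=> [t [n _]|t]; rewrite /D /= !in_itv/= !andbT.
    by apply: lt_le_trans; rewrite invr_gt0.
  move=> t0; exists (Num.truncn t^-1) => //=; rewrite in_itv/= andbT.
  rewrite invf_ple ?posrE//; exact/ltW/Num.Theory.truncnS_gt.
have mk : measurable_fun (`]0, +oo[%classic : set (measurableTypeR R)) k.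
  apply: open_continuous_measurable_fun => //.
  by move=> t; rewrite inE/= in_itv/= andbT; exact: ck.
have cvg1 : ((\int[mu]_(t in D n) (k t)%:E) @[n --> \oo] -->
    \int[mu]_(t in `]0%R, +oo[) (k t)%:E)%E.
  rewrite -bigD; apply: ge0_nondecreasing_set_cvg_integral => //.
  - move=> m n mn; apply/subsetPset => t /=; rewrite /D/= !in_itv/= !andbT.
    by apply: le_trans; rewrite lef_pV2 ?posrE// ler_nat.
  - by move=> n; rewrite /D; exact: measurable_itv.
  - move=> n; apply/measurable_EFinP; apply: measurable_funS mk => //.
    by rewrite -bigD; exact: bigcup_sup.
  - by move=> n t _; rewrite lee_fin.
have cvg2 : ((\int[mu]_(t in D n) (k t)%:E) @[n --> \oo] -->
    (c^-1 * (M / 2))%R%:E)%E.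
  under eq_cvg => n do rewrite ik//.
  apply: cvg_EFin; first exact: nearW.
  rewrite [X in _ --> X](_ : _ = c^-1 * M - H 0); last first.
    by rewrite /H mulr0 normr0 powR0 ?gt_eqF// I0; field; rewrite gt_eqF.
  apply: cvgB; first exact: cvg_cst.
  apply: (@cvg_comp _ _ _ (fun n => n.+1%:R^-1 : R) H _ (nbhs (0:R))).
    exact: cvg_harmonic.
  exact: cH.
exact: (cvg_unique _ cvg1 cvg2).
Unshelve. all: by end_near. Qed.

Lemma subbotin_normE : subbotin_norm r = M.
Proof.
rewrite /subbotin_norm /Gamma /Rintegral Gamma_integral_subbotin /=.
have : 0 < r `^ (1 / r - 1) by exact: powR_gt0.
by move=> c0; rewrite -[fine _]/M; field; rewrite gt_eqF.
Qed.
End norm.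

(** * The Subbotin distribution function and its quantiles *)

Section cdf.
Context {R : realType} (r : R) (r_gt0 : 0 < r).
Local Notation mu := (@lebesgue_measure R).
Local Notation w := (subbotin_weight r).
Local Notation I x := (\int[mu]_(y in `]-oo, x]) w y).
Local Notation M := (\int[mu]_y w y).
Local Notation phi := (subbotin_pdf r).
Local Notation Phi := (subbotin_cdf r).

Let w_ge0 y : 0 <= w y. Proof. exact/ltW/subbotin_weight_gt0. Qed.
Let cw : continuous w. Proof. exact: continuous_subbotin_weight. Qed.
Let iw := integrable_subbotin_weight r_gt0.

Let I_ltS x : I x < I (x + 1).
Proof.
have xx1 : x < x + 1 by rewrite ltrDl.
have [||c _] := @MVT R (fun x : R => I x) w _ _ xx1.
- by move=> z _; exact: is_derive_cumulative.
- apply: derivable_within_continuous => z _.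
  by have [] := is_derive_cumulative cw iw z.
rewrite (addrAC x) subrr add0r mulr1 => e.
by rewrite -subr_gt0 e subbotin_weight_gt0.
Qed.

Let I_lt x : I x < M.
Proof. exact: lt_le_trans (I_ltS x) (cumulative_le w_ge0 iw _). Qed.

Lemma subbotin_mass_gt0 : 0 < M.
Proof. by apply: le_lt_trans (I_lt 0); exact: Rintegral_ge0. Qed.

Lemma subbotin_pdfE y : phi y = w y / M.
Proof. by rewrite /subbotin_pdf subbotin_normE. Qed.

Lemma subbotin_pdf_gt0 y : 0 < phi y.
Proof.
by rewrite subbotin_pdfE divr_gt0 ?subbotin_weight_gt0 ?subbotin_mass_gt0.
Qed.

Lemma subbotin_cdfE x : Phi x = I x / M.
Proof.
rewrite /subbotin_cdf -RintegralZr//; last exact: integrableS iw.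
by apply: eq_Rintegral => y _; rewrite subbotin_pdfE.
Qed.

Lemma is_derive_subbotin_cdf (x : R) : is_derive x 1 Phi (phi x).
Proof.
have dI := is_derive_cumulative cw iw x.
have -> : Phi = M^-1 \*: (fun x : R => I x : R).
  by apply/funext => y; rewrite subbotin_cdfE mulrC.
by rewrite subbotin_pdfE mulrC; exact: is_deriveZ.
Qed.

Lemma continuous_subbotin_cdf : continuous Phi.
Proof.
move=> x; apply/differentiable_continuous/derivable1_diffP.
by have [] := is_derive_subbotin_cdf x.
Qed.

Lemma nondecreasing_subbotin_cdf : nondecreasing_fun Phi.
Proof.
move=> x y xy; rewrite !subbotin_cdfE ler_pM2r ?invr_gt0 ?subbotin_mass_gt0//.
exact: nondecreasing_cumulative.
Qed.

Lemma subbotin_cdf_lt1 x : Phi x < 1.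
Proof. by rewrite subbotin_cdfE ltr_pdivrMr ?subbotin_mass_gt0 // mul1r. Qed.

Lemma cvg_subbotin_cdfy : Phi x @[x --> +oo] --> (1 : R).
Proof.
have : I x / M @[x --> +oo] --> M / M by apply: cvgMl; exact: cvg_cumulativey.
rewrite divff ?gt_eqF ?subbotin_mass_gt0//.
by under [X in X @ _ --> _ -> _]eq_fun do rewrite -subbotin_cdfE.
Qed.

Lemma subbotin_cdfN x : Phi (- x) = 1 - Phi x.
Proof.
rewrite !subbotin_cdfE (cumulativeN w_ge0 cw iw (subbotin_weightN r)).
by rewrite mulrBl divff// gt_eqF// subbotin_mass_gt0.
Qed.

(** Every value in [(0, 1)] is attained: by symmetry [Phi (- `|z|)] is below [v]
    and [Phi `|z|] above it for [z] large, and [Phi] is continuous. *)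
Lemma subbotin_quantileK v : 0 < v < 1 -> Phi (subbotin_quantile r v) = v.
Proof.
move=> /andP[v0 v1].
have [z [vz v1z]] : exists z, v < Phi z /\ 1 - v < Phi z.
  near (+oo : set_system R) => z; exists z; split; near: z.
    exact: cvgr_gt cvg_subbotin_cdfy _ v1.
  by apply: cvgr_gt cvg_subbotin_cdfy _ _; rewrite ltrBlDr ltrDl.
have zNz : - `|z| <= `|z| by rewrite (@le_trans _ _ 0)// oppr_le0.
have zz : Phi z <= Phi `|z|.
  by apply: nondecreasing_subbotin_cdf; exact: ler_norm.
have [||c _ cv] := @IVT R Phi _ _ v zNz.
- by apply: continuous_subspaceT; exact: continuous_subbotin_cdf.
- rewrite subbotin_cdfN ge_min le_max; apply/andP; split; apply/orP.
    by left; lra.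
  by right; lra.
by rewrite /subbotin_quantile pinvK// inE; exists c.
Unshelve. all: by end_near. Qed.

Lemma cvg_subbotin_quantile : subbotin_quantile r (1 - y) @[y --> 0^'+] --> +oo.
Proof.
apply/cvgryPgt => z; near=> y.
rewrite ltNge; apply/negP => /nondecreasing_subbotin_cdf.
have y0 : 0 < y by near: y; exact: nbhs_right_gt.
have y1 : y < 1 by near: y; apply: nbhs_right_lt.
rewrite subbotin_quantileK ?subr_gt0 ?y1 ?ltrBlDr ?ltrDl//.
have : y < 1 - Phi z.
  by near: y; apply: nbhs_right_lt; rewrite subr_gt0 subbotin_cdf_lt1.
lra.
Unshelve. all: by end_near. Qed.

End cdf.

(** * Tail asymptotics *)

Section tail.
Context {R : realType} (r : R) (r_gt0 : 0 < r).
Local Notation phi := (subbotin_pdf r).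
Local Notation Phi := (subbotin_cdf r).
Local Notation h x := (phi x / (1 - Phi x)).

Lemma is_derive_subbotin_tail (x : R) :
  is_derive x 1 (fun x : R => 1 - Phi x) (- phi x).
Proof.
have dP := is_derive_subbotin_cdf r_gt0 x.
by have := is_deriveB (is_derive_cst (1 : R) x 1) dP; rewrite sub0r.
Qed.

Lemma is_derive_subbotin_pdf (x : R) : 0 < x ->
  is_derive x 1 phi (- (x `^ (r - 1) * phi x)).
Proof.
move=> x0.
have dp : is_derive x 1 (fun x : R => - r^-1 * x `^ r)
    (- r^-1 * (r * x `^ (r - 1))).
  by apply: is_deriveZ; exact: is_derive1_powR.
have de := @is_derive1_comp R expR _ x _ _ (is_derive_expR _) dp.
have dN := is_deriveZ (subbotin_norm r)^-1 de.
rewrite (_ : - _ = (subbotin_norm r)^-1 *: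
    (expR (- r^-1 * x `^ r) * (- r^-1 * (r * x `^ (r - 1))))).
  apply: near_eq_is_derive dN; near=> y.
  rewrite /subbotin_pdf /GRing.scale/= ger0_norm.
    by rewrite [LHS]mulrC mulNr [r^-1 * _]mulrC.
  by rewrite ltW//; near: y; exact: lt_nbhsr.
rewrite /subbotin_pdf /GRing.scale/= ger0_norm ?ltW//.
rewrite [- r^-1 * x `^ r]mulNr [r^-1 * x `^ r]mulrC mulNr mulKf ?gt_eqF//.
ring.
Unshelve. all: by end_near. Qed.

Lemma cvg_powR_subbotin_pdf : x `^ (1 - r) * phi x @[x --> +oo] --> (0 : R).
Proof.
have [K K0 wK] := subbotin_weight_le r_gt0.
have N0 : 0 < subbotin_norm r by rewrite subbotin_normE// subbotin_mass_gt0.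
apply: (@squeeze_cvgr _ _ _ _ (fun=> 0) (fun x => K / subbotin_norm r * x^-1)).
- near=> x; have x1 : 1 <= x by near: x; apply: nbhs_pinfty_ge; exact: num_real.
  have x0 : 0 < x by exact: lt_le_trans x1.
  rewrite mulr_ge0 ?powR_ge0 ?(ltW (subbotin_pdf_gt0 r_gt0 _))//=.
  rewrite ler_pdivlMr// /subbotin_pdf -/(subbotin_weight r x).
  rewrite mulrA mulrAC ler_pM2r ?invr_gt0// mulrAC.
  rewrite -{2}(powRr1 (ltW x0)) -powRD; last first.
    by rewrite (gt_eqF x0) implybT.
  apply: le_trans (wK x); rewrite mulrC ler_pM2l ?subbotin_weight_gt0//.
  apply: (@le_trans _ _ (x `^ 2%:R)); first last.
    by rewrite powR_mulrn ?(ltW x0)// lerDr.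
  by rewrite ler_powR// (natrD _ 1 1) lerD2r gerBl ltW.
- exact: cvg_cst.
- rewrite -(mulr0 (K / subbotin_norm r)); apply: cvgMr.
  apply/gtr0_cvgV0 => //; near=> x; near: x.
  by apply: nbhs_pinfty_gt; exact: num_real.
Unshelve. all: by end_near. Qed.

(** L'Hopital's rule: the derivatives of numerator and denominator are both
    proportional to [phi], and their quotient is [1 - (1 - r) * x `^ (- r)]. *)
Lemma cvg_subbotin_mills :
  x `^ (1 - r) * phi x / (1 - Phi x) @[x --> +oo] --> (1 : R).
Proof.
apply: (@lhopital_pinfty R _ (fun x => ((1 - r) * x `^ (- r) - 1) * phi x) _
  (fun x => - phi x)).
- near=> x; have x0 : 0 < x by near: x; apply: nbhs_pinfty_gt; exact: num_real.
  have dpow := is_derive1_powR (1 - r) x0.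
  have dd := is_deriveM dpow (is_derive_subbotin_pdf x0).
  apply: is_derive_eq dd _.
  rewrite /GRing.scale/=.
  have -> : x `^ (1 - r) * - (x `^ (r - 1) * phi x) = - phi x.
    rewrite mulrN mulrA -powRD; last by rewrite (gt_eqF x0) implybT.
    by rewrite addrA subrK subrr powRr0 mul1r.
  by rewrite (_ : 1 - r - 1 = - r); ring.
- by near=> x; exact: is_derive_subbotin_tail.
- near=> x; rewrite subr_eq0 gt_eqF//; exact: subbotin_cdf_lt1.
- near=> x; rewrite oppr_eq0 gt_eqF//; exact: subbotin_pdf_gt0.
- exact: cvg_powR_subbotin_pdf.
- rewrite -(subrr (1 : R)); apply: cvgB; first exact: cvg_cst.
  exact: cvg_subbotin_cdfy.
- apply: (@cvg_trans _ ((1 - (1 - r) * x `^ (- r)) @[x --> +oo])).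
    apply: near_eq_cvg; near=> x.
    have := subbotin_pdf_gt0 r_gt0 x => p0.
    by field; rewrite gt_eqF.
  have : 1 - (1 - r) * x `^ (- r) @[x --> +oo] --> 1 - (1 - r) * 0.
    by apply: cvgB; [exact: cvg_cst | apply: cvgMr; exact: cvg_powRN].
  by rewrite mulr0 subr0.
Unshelve. all: by end_near. Qed.

(** By the Mills ratio [h x] is equivalent to [x `^ (r - 1)], so the quotient
    behaves like [(1 - mu / x) `^ (r - 1)]. *)
Lemma subbotin_hazard_shift (mu : R) :
  h (x - mu) / h x @[x --> +oo] --> (1 : R).
Proof.
have shift : x - mu @[x --> +oo] --> +oo.
  apply/cvgryPgt => A; near=> x; rewrite ltrBrDr.
  by near: x; apply: nbhs_pinfty_gt; exact: num_real.
pose q x := x `^ (1 - r) * phi x / (1 - Phi x).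
have q1 : q x @[x --> +oo] --> (1 : R) by exact: cvg_subbotin_mills.
have qmu : q (x - mu) @[x --> +oo] --> (1 : R).
  exact: (cvg_comp _ _ shift q1).
have base : 1 - mu * x^-1 @[x --> +oo] --> (1 : R).
  have : 1 - mu * x^-1 @[x --> +oo] --> 1 - mu * 0.
    apply: cvgB; [exact: cvg_cst | apply: cvgMr; apply/gtr0_cvgV0 => //].
    by near=> x; near: x; apply: nbhs_pinfty_gt; exact: num_real.
  by rewrite mulr0 subr0.
have pw : (1 - mu * x^-1) `^ (r - 1) @[x --> +oo] --> (1 : R).
  have : derivable (@powR R ^~ (r - 1)) 1 1.
    by apply: derivable_powR; rewrite in_itv/= andbT.
  move=> /derivable1_diffP/differentiable_continuous cp.
  by have := cvg_comp _ _ base cp; rewrite powR1.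
apply: (@cvg_trans _ ((q (x - mu) / q x * (1 - mu * x^-1) `^ (r - 1))
  @[x --> +oo])).
  apply: near_eq_cvg; near=> x.
  have x0 : 0 < x by near: x; apply: nbhs_pinfty_gt; exact: num_real.
  have xmu : 0 < x - mu.
    by rewrite subr_gt0; near: x; apply: nbhs_pinfty_gt; exact: num_real.
  have -> : 1 - mu * x^-1 = (x - mu) * x^-1 by rewrite mulrBl divff// gt_eqF.
  rewrite powRM ?invr_ge0 ?(ltW x0) ?(ltW xmu)// -(powR_inv1 (ltW x0)).
  rewrite -powRrM mulN1r opprB.
  rewrite /q -(opprB 1 r) powRN.
  have a0 := powR_gt0 (1 - r) xmu; have b0 := powR_gt0 (1 - r) x0.
  have tail_gt0 z : 0 < 1 - Phi z by rewrite subr_gt0 subbotin_cdf_lt1.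
  have c0 := tail_gt0 x; have d0 := tail_gt0 (x - mu).
  have e0 := subbotin_pdf_gt0 r_gt0 x.
  by field; rewrite !gt_eqF.
have := cvgM (cvgM qmu (cvgV (oner_neq0 R) q1)) pw.
by rewrite invr1 !mulr1; apply.
Unshelve. all: by end_near. Qed.

End tail.

(** * Regular variation *)

Unset Implicit Arguments.

Theorem proposition4p1 (R : realType) (r mu : R) (hr : 0 < r) (hmu : 0 < mu)
    (c : R) (hc : 0 < c) :
  shifted_pvalue_cdf mu r (c * y) / shifted_pvalue_cdf mu r y @[y --> 0^'+]
    --> c.
Proof.
pose S x := 1 - subbotin_cdf r x.
have S0 x : 0 < S x by rewrite subr_gt0 subbotin_cdf_lt1.
have shift := ln_survival_shift S0 (subbotin_pdf_gt0 hr)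
  (is_derive_subbotin_tail hr) (subbotin_hazard_shift hr mu).
pose x_ y := subbotin_quantile r (1 - y).
have Sx y : 0 < y < 1 -> S (x_ y) = y.
  move=> y01; rewrite /S /x_ subbotin_quantileK//; last by lra.
  by rewrite opprB addrC subrK.
(* [c * y] tends to 0 from the right, so [x_] also diverges along it. *)
have cy0 : c * y @[y --> 0^'+] --> (0 : R)^'+.
  have cl : c * y @[y --> (0 : R)] --> (0 : R).
    by have := @mulrl_continuous R c 0; rewrite /continuous_at mulr0.
  move=> B HB; suff : \forall y \near (0 : R)^'+, B (c * y) by [].
  have cB : \forall y \near (0 : R), 0 < c * y -> B (c * y) by exact: cl _ HB.
  near=> y; have /[!pmulr_rgt0]// : 0 < c * y -> B (c * y).
    by near: y; exact: cvg_within cB.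
  by apply; near: y; exact: nbhs_right_gt.
have xy := cvg_subbotin_quantile hr.
have xcy : x_ (c * y) @[y --> 0^'+] --> +oo by exact: (cvg_comp _ _ cy0 xy).
have lnF : ln (S (x_ (c * y) - mu)) - ln (S (x_ y - mu)) @[y --> 0^'+] --> ln c.
  apply/cvgrPdist_le => e e0.
  have lnc_gt0 : 0 < `|ln c| + 1 by rewrite ltr_wpDl.
  (* The denominator stays positive for [c = 1]. *)
  have [A HA] := shift (e / (`|ln c| + 1)) (divr_gt0 e0 lnc_gt0).
  near=> y.
  have y0 : 0 < y by near: y; exact: nbhs_right_gt.
  have y1 : y < 1 by near: y; apply: nbhs_right_lt.
  have cy1 : c * y < 1.
    rewrite mulrC -ltr_pdivlMr//; near: y; apply: nbhs_right_lt.
    by rewrite divr_gt0.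
  have Ax : A < x_ y by near: y; exact: cvgry_gt xy A.
  have Axc : A < x_ (c * y) by near: y; exact: cvgry_gt xcy A.
  have := HA _ _ Ax Axc.
  rewrite !Sx ?y0 ?mulr_gt0// lnM ?posrE// addrK distrC => /le_trans; apply.
  rewrite mulrAC ler_pdivrMr//.
  by rewrite ler_pM2l// lerDl.
apply: (@cvg_trans _ (expR (ln (S (x_ (c * y) - mu)) - ln (S (x_ y - mu)))
  @[y --> 0^'+])).
  apply: near_eq_cvg; near=> y.
  by rewrite expRB !lnK ?posrE.
have := cvg_comp _ _ lnF (@continuous_expR R (ln c)).
by rewrite lnK.
Unshelve. all: by end_near. Qed.
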